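(* Let $(F:\mathcal{C}\to\mathcal{D},\,G:\mathcal{D}\to\mathcal{C})$ be an adjoint pair of functors ($F$ left adjoint to $G$), with unit $\eta:\mathrm{Id}_{\mathcal{C}}\to GF$ and counit $\epsilon:FG\to\mathrm{Id}_{\mathcal{D}}$. Then: (i) $F$ is semiseparable if and only if $\eta$ is regular; (ii) $G$ is semiseparable if and only if $\epsilon$ is regular.
   Context: For a functor $F:\mathcal{C}\to\mathcal{D}$ let $\mathcal{F}^F:\mathrm{Hom}_{\mathcal{C}}(-,-)\to\mathrm{Hom}_{\mathcal{D}}(F-,F-)$ be the natural transformation (of functors $\mathcal{C}^{\mathrm{op}}\times\mathcal{C}\to\mathsf{Set}$) with $\mathcal{F}^F_{X,Y}(f)=F(f)$. $F$ is semiseparable if there is a natural transformation $\mathcal{P}^F:\mathrm{Hom}_{\mathcal{D}}(F-,F-)\to\mathrm{Hom}_{\mathcal{C}}(-,-)$ with $\mathcal{F}^F\circ\mathcal{P}^F\circ\mathcal{F}^F=\mathcal{F}^F$. A natural transformation $f$ is regular if there is a natural transformation $g$ (in the opposite direction) with $f\circ g\circ f=f$. *)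

(* Defs.v *)
From Stdlib Require Import FunctionalExtensionality ProofIrrelevance.

Set Implicit Arguments.
Unset Strict Implicit.
Unset Printing Implicit Defensive.

Declare Scope cat_scope.
Delimit Scope cat_scope with cat.

Record category := Category {
  ob :> Type;
  hom : ob -> ob -> Type;
  idm : forall X, hom X X;
  comp : forall X Y Z, hom Y Z -> hom X Y -> hom X Z;
  comp_idl : forall X Y (f : hom X Y), comp (idm Y) f = f;
  comp_idr : forall X Y (f : hom X Y), comp f (idm X) = f;
  comp_assoc : forall X Y Z W (h : hom Z W) (g : hom Y Z) (f : hom X Y),
    comp h (comp g f) = comp (comp h g) f
}.
Arguments hom {c} X Y.
Arguments idm {c} X.
Arguments comp {c X Y Z} g f.
Arguments comp_idl {c X Y} f.
Arguments comp_idr {c X Y} f.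
Arguments comp_assoc {c X Y Z W} h g f.
Notation "g ∘ f" := (comp g f) (at level 40, left associativity) : cat_scope.
Open Scope cat_scope.

Record functor (C D : category) := Functor {
  fob :> C -> D;
  fmap : forall X Y : C, hom X Y -> hom (fob X) (fob Y);
  fmap_id : forall X : C, fmap (idm X) = idm (fob X);
  fmap_comp : forall (X Y Z : C) (g : hom Y Z) (f : hom X Y),
    fmap (g ∘ f) = fmap g ∘ fmap f
}.
Arguments fmap {C D} F {X Y} f : rename.
Arguments fmap_id {C D} F X : rename.
Arguments fmap_comp {C D} F {X Y Z} g f : rename.

Record nattrans (C D : category) (F G : functor C D) := NatTrans {
  component :> forall X : C, hom (F X) (G X);
  naturality : forall (X Y : C) (f : hom X Y),
    fmap G f ∘ component X = component Y ∘ fmap F f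
}.
Arguments naturality {C D F G} n {X Y} f.

Lemma nattrans_ext (C D : category) (F G : functor C D) (a b : nattrans F G) :
  (forall X, a X = b X) -> a = b.
Proof.
destruct a as [a Ha], b as [b Hb]; simpl; intro E.
assert (a = b) as -> by (apply functional_extensionality_dep; exact E).
f_equal; apply proof_irrelevance.
Qed.

Definition functor_id (C : category) : functor C C.
Proof.
refine (@Functor C C (fun X => X) (fun X Y f => f) _ _); reflexivity.
Defined.

Definition functor_comp (C D E : category) (G : functor D E) (F : functor C D) :
  functor C E.
Proof.
refine (@Functor C E (fun X => G (F X)) (fun X Y f => fmap G (fmap F f)) _ _).
- intro X; rewrite !fmap_id; reflexivity.
- intros X Y Z g f; rewrite !fmap_comp; reflexivity.
Defined.

Notation "G ∘f F" := (functor_comp G F) (at level 40, left associativity)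
  : cat_scope.

Definition nattrans_comp (C D : category) (F G H : functor C D)
  (b : nattrans G H) (a : nattrans F G) : nattrans F H.
Proof.
refine (@NatTrans C D F H (fun X => b X ∘ a X) _).
intros X Y f; rewrite comp_assoc, naturality, <- !comp_assoc, naturality.
reflexivity.
Defined.

Notation "b ∘n a" := (nattrans_comp b a) (at level 40, left associativity)
  : cat_scope.

Definition opposite (C : category) : category.
Proof.
refine (@Category C (fun X Y => hom Y X) (fun X => idm X)
          (fun X Y Z g f => f ∘ g) _ _ _).
- intros; apply comp_idr.
- intros; apply comp_idl.
- intros; symmetry; apply comp_assoc.
Defined.

Definition product (C D : category) : category.
Proof.
refine (@Category (C * D)%type
          (fun X Y => (hom (fst X) (fst Y) * hom (snd X) (snd Y))%type)
          (fun X => (idm (fst X), idm (snd X)))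
          (fun X Y Z g f => (fst g ∘ fst f, snd g ∘ snd f)) _ _ _).
- intros X Y [f1 f2]; simpl; rewrite !comp_idl; reflexivity.
- intros X Y [f1 f2]; simpl; rewrite !comp_idr; reflexivity.
- intros; simpl; rewrite !comp_assoc; reflexivity.
Defined.

(* Sets are types with Leibniz equality; hom-types of every category live in
   the universe of objects of SET, i.e. categories are locally small. *)
Definition SET : category.
Proof.
refine (@Category Type (fun A B => A -> B) (fun A x => x)
          (fun A B C g f x => g (f x)) _ _ _); reflexivity.
Defined.

Definition functor_op (C D : category) (F : functor C D) :
  functor (opposite C) (opposite D).
Proof.
refine (@Functor (opposite C) (opposite D) F (fun X Y f => fmap F f) _ _).
- intro X; apply (fmap_id F).
- intros X Y Z g f; apply (fmap_comp F).
Defined.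

Definition functor_prod (C C' D D' : category)
  (F : functor C D) (F' : functor C' D') :
  functor (product C C') (product D D').
Proof.
refine (@Functor (product C C') (product D D')
          (fun X => (F (fst X), F' (snd X)))
          (fun X Y f => (fmap F (fst f), fmap F' (snd f))) _ _).
- intro X; simpl; rewrite !fmap_id; reflexivity.
- intros X Y Z g f; simpl; rewrite !fmap_comp; reflexivity.
Defined.

(* Hom_C(-,-) : C^op x C -> SET *)
Definition hom_functor (C : category) : functor (product (opposite C) C) SET.
Proof.
refine (@Functor (product (opposite C) C) SET
          (fun X => @hom C (fst X) (snd X))
          (fun X Y u h => @comp C _ _ _ (snd u) (@comp C _ _ _ h (fst u))) _ _).
- intro X; apply functional_extensionality; intro h; simpl.
  rewrite comp_idr, comp_idl; reflexivity.
- intros X Y Z v u; apply functional_extensionality; intro h; simpl.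
  rewrite !comp_assoc; reflexivity.
Defined.

(* Hom_D(F-,F-) : C^op x C -> SET *)
Definition hom_functor_along (C D : category) (F : functor C D) :
  functor (product (opposite C) C) SET :=
  hom_functor D ∘f functor_prod (functor_op F) F.

Definition hom_action (C D : category) (F : functor C D) :
  nattrans (hom_functor C) (hom_functor_along F).
Proof.
refine (@NatTrans _ _ (hom_functor C) (hom_functor_along F)
          (fun X => @fmap C D F (fst X) (snd X)) _).
intros X Y u; apply functional_extensionality; intro h; simpl.
rewrite !fmap_comp; reflexivity.
Defined.

Definition semiseparable (C D : category) (F : functor C D) : Prop :=
  exists P : nattrans (hom_functor_along F) (hom_functor C),
    hom_action F ∘n P ∘n hom_action F = hom_action F.

Definition regular (C D : category) (F G : functor C D) (f : nattrans F G) :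
  Prop :=
  exists g : nattrans G F, f ∘n g ∘n f = f.

(* F is the left adjoint; the two conjuncts are the triangle identities. *)
Definition adjunction (C D : category) (F : functor C D) (G : functor D C)
  (eta : nattrans (functor_id C) (G ∘f F))
  (epsilon : nattrans (F ∘f G) (functor_id D)) : Prop :=
  (forall X : C, epsilon (F X) ∘ fmap F (eta X) = idm (F X)) /\
  (forall Y : D, fmap G (epsilon Y) ∘ eta (G Y) = idm (G Y)).

(* Main.v *)
(* P : Hom(F-,F-) -> Hom(-,-) and nu : GF -> Id determine each other, in the
   manner of the Yoneda lemma, through nu_X = P(epsilon_{FX}) and
   P(h) = nu_Y . G h . eta_X; by the triangle identities, F P F = F and
   eta nu eta = eta both say that F(nu_X . eta_X) = id.  Dually, for G one takes
   nu_Y = P(eta_{GY}) and P(h) = epsilon_Y . F h . nu_X. *)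
From Stdlib Require Import FunctionalExtensionality.
Require Import Defs.

(** A morphism of C^op x C is a pair [(a, b)], so naturality is one two-sided equation. Currying
    keeps the product category out of the adjunction arguments. *)
Lemma semiseparableP (C D : category) (F : functor C D) :
  semiseparable F <->
  exists P : forall X Y : C, hom (F X) (F Y) -> hom X Y,
    (forall (X X' Y Y' : C) (a : hom X' X) (b : hom Y Y')
       (h : hom (F X) (F Y)),
       b ∘ (P X Y h ∘ a) = P X' Y' (fmap F b ∘ (h ∘ fmap F a))) /\
    (forall (X Y : C) (f : hom X Y),
       fmap F (P X Y (fmap F f)) = fmap F f).
Proof.
split.
- intros [P HP].
  exists (fun X Y => P (X, Y)); split.
  + intros X X' Y Y' a b h.
    exact (equal_f (@naturality _ _ _ _ P (X, Y) (X', Y') (a, b)) h).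
  + intros X Y f.
    assert (E := f_equal (fun t : nattrans (hom_functor C) (hom_functor_along F) =>
                         t (X, Y)) HP).
    exact (equal_f E f).
- intros [P [natP HP]].
  unshelve eexists.
  + refine (@NatTrans _ _ (hom_functor_along F) (hom_functor C)
              (fun Z => P (fst Z) (snd Z)) _).
    intros [X Y] [X' Y'] [a b]; apply functional_extensionality; intro h.
    apply natP.
  + apply nattrans_ext; intros [X Y]; apply functional_extensionality; intro f.
    apply HP.
Qed.

Lemma regularP (C D : category) (F G : functor C D) (f : nattrans F G) :
  regular f <->
  exists g : nattrans G F, forall X, f X ∘ (g X ∘ f X) = f X.
Proof.
split; intros [g Hg]; exists g.
- intro X; rewrite comp_assoc.
  exact (f_equal (fun t : nattrans F G => t X) Hg).
- apply nattrans_ext; intro X; simpl; rewrite <- comp_assoc; apply Hg.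
Qed.

Section Adjunction.

Context (C D : category) (F : functor C D) (G : functor D C).
Context (eta : nattrans (functor_id C) (G ∘f F)).
Context (epsilon : nattrans (F ∘f G) (functor_id D)).
Hypothesis adj : adjunction eta epsilon.

(* The objects given to [@comp] keep [functor_id] and [∘f] out of the implicit
   arguments, where they would block rewriting. *)
Lemma unit_natural (X Y : C) (f : hom X Y) :
  @comp C X _ _ (fmap G (fmap F f)) (eta X) = @comp C X Y (G (F Y)) (eta Y) f.
Proof. exact (naturality eta f). Qed.

Lemma counit_natural (X Y : D) (f : hom X Y) :
  @comp D (F (G X)) _ _ f (epsilon X) =
  @comp D _ (F (G Y)) Y (epsilon Y) (fmap F (fmap G f)).
Proof. exact (naturality epsilon f). Qed.

Lemma triangle_left (X : C) :
  @comp D _ (F (G (F X))) (F X) (epsilon (F X))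
    (@fmap C D F X (G (F X)) (eta X)) = idm (F X).
Proof. exact (proj1 adj X). Qed.

Lemma triangle_right (Y : D) :
  @comp C (G Y) (G (F (G Y))) _ (@fmap D C G (F (G Y)) Y (epsilon Y))
    (eta (G Y)) = idm (G Y).
Proof. exact (proj2 adj Y). Qed.

Lemma semiseparable_regular_unit : semiseparable F -> regular eta.
Proof.
intros [P [natP HP]]%semiseparableP; apply regularP.
unshelve eexists.
- refine (@NatTrans _ _ (G ∘f F) (functor_id C)
            (fun X => P (G (F X)) X (epsilon (F X))) _).
  intros X Y f; simpl.
  (* Padding with identities makes [natP] apply on both sides; what remains under [P] is naturality
     of [epsilon] at F f. *)
  rewrite <- (comp_idr (P _ _ (epsilon (F X)))), natP.
  rewrite <- (comp_idl (P _ _ _ ∘ _)), natP.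
  rewrite !fmap_id, comp_idr, comp_idl.
  f_equal; apply counit_natural.
- intro X; simpl.
  (* The triangle identity gives nu_X . eta_X = P(F id). Naturality of [eta] moves this to the left
     of [eta], under G F, where [HP] turns it into the identity. *)
  rewrite <- (comp_idl (P _ _ _ ∘ _)), natP.
  rewrite triangle_left, comp_idr, <- unit_natural, HP, !fmap_id.
  apply comp_idl.
Qed.

Lemma regular_unit_semiseparable : regular eta -> semiseparable F.
Proof.
intros [nu Hnu]%regularP; simpl in Hnu; apply semiseparableP.
assert (Fnu : forall X : C, fmap F (@comp C X (G (F X)) X (nu X) (eta X)) = idm (F X)).
(* Inserting epsilon . F eta = id on the left produces F(eta . nu . eta), to which regularity
   applies. *)
{ intro X.
  rewrite <- (comp_idl (fmap F _)), <- triangle_left, <- comp_assoc,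
    <- fmap_comp.
  rewrite Hnu; reflexivity. }
exists (fun X Y h =>
          @comp C X (G (F Y)) Y (nu Y) (@comp C X _ _ (fmap G h) (eta X))); split.
- intros X X' Y Y' a b h.
  (* Naturality of [eta] absorbs [a], that of [nu] absorbs [b]. *)
  assert (E := naturality nu b); simpl in E.
  rewrite !fmap_comp, <- !comp_assoc, unit_natural.
  rewrite (comp_assoc b), E, <- !comp_assoc; reflexivity.
- intros X Y f.
  (* Here P(F f) = (nu_Y . eta_Y) . f, and F kills the first factor. *)
  rewrite unit_natural, comp_assoc, fmap_comp, Fnu; apply comp_idl.
Qed.

Lemma semiseparable_regular_counit : semiseparable G -> regular epsilon.
Proof.
intros [P [natP HP]]%semiseparableP; apply regularP.
unshelve eexists.
- refine (@NatTrans _ _ (functor_id D) (F ∘f G)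
            (fun Y => P Y (F (G Y)) (eta (G Y))) _).
  intros X Y f; simpl.
  rewrite <- (comp_idr (P _ _ (eta (G X)))), natP.
  rewrite <- (comp_idl (P _ _ _ ∘ _)), natP.
  rewrite !fmap_id, comp_idr, comp_idl.
  f_equal; apply unit_natural.
- intro Y; simpl.
  (* Dually, epsilon_Y . nu_Y = P(id), and naturality of [epsilon] moves it to the right, under F G;
     writing id as G id lets [HP] apply. *)
  rewrite comp_assoc.
  rewrite <- (comp_idr (P _ _ _)), natP.
  rewrite fmap_id, comp_idr, triangle_right, counit_natural.
  rewrite <- (fmap_id G), HP, !fmap_id.
  apply comp_idr.
Qed.

Lemma regular_counit_semiseparable : regular epsilon -> semiseparable G.
Proof.
intros [nu Hnu]%regularP; simpl in Hnu; apply semiseparableP.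
assert (Gnu : forall Y : D, fmap G (@comp D Y (F (G Y)) Y (epsilon Y) (nu Y)) = idm (G Y)).
(* The triangle is now inserted on the right, producing G(epsilon . nu . epsilon). *)
{ intro Y.
  rewrite <- (comp_idr (fmap G _)), <- triangle_right, comp_assoc,
    <- fmap_comp.
  rewrite <- comp_assoc, Hnu; reflexivity. }
exists (fun X Y h =>
          @comp D X (F (G Y)) Y (epsilon Y) (@comp D X _ _ (fmap F h) (nu X)));
  split.
- intros X X' Y Y' a b h.
  assert (E := naturality nu a); simpl in E.
  rewrite !fmap_comp, <- !comp_assoc, E.
  rewrite (comp_assoc b), counit_natural, <- !comp_assoc; reflexivity.
- intros X Y f.
  rewrite comp_assoc, <- counit_natural, <- comp_assoc, fmap_comp, Gnu.
  apply comp_idr.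
Qed.

End Adjunction.

Theorem theorem2p1 (C D : category) (F : functor C D) (G : functor D C)
  (eta : nattrans (functor_id C) (G ∘f F))
  (epsilon : nattrans (F ∘f G) (functor_id D))
  (adj : adjunction eta epsilon) :
  (semiseparable F <-> regular eta) /\ (semiseparable G <-> regular epsilon).
Proof.
split; split.
- exact (semiseparable_regular_unit _ _ _ _ _ _ adj).
- exact (regular_unit_semiseparable _ _ _ _ _ _ adj).
- exact (semiseparable_regular_counit _ _ _ _ _ _ adj).
- exact (regular_counit_semiseparable _ _ _ _ _ _ adj).
Qed.
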